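(* Let $q:=\lfloor(m_1-1)/(n-1)\rfloor$ and $l:=m_1-q(n-1)$. For $\lambda\in\{0,\dots,m_n-1\}$ set $s_\lambda:=\left(\left\lceil\frac{\lambda}{n-1}\right\rceil m_n-\lambda d,\ \lambda d\right)\in\mathbb N^2$. Then the multigraded Noether resolution of $K[\mathcal P_r]$ is given by the following expressions. 1. If $r=2$ and $m_1\ge2$: $$0\to\Big(\bigoplus_{\lambda=0,\ \lambda\notin\Lambda_1}^{m_n-1}A\cdot s_\lambda\Big)\oplus\Big(\bigoplus_{\lambda\in\Lambda_1}A\cdot(s_\lambda+a_n)\Big)\to K[\mathcal P_2]\to0,$$ where $\Lambda_1:=\{\mu(n-1)-1\mid1\le\mu\le q+d+\epsilon\}$, with $\epsilon=1$ if $l=n-1$ and $\epsilon=0$ otherwise. 2. If $r\in\{3,\dots,n-2\}$ and $r\le m_1$: $$0\to\Big(\bigoplus_{\lambda=0,\ \lambda\ne n-r}^{m_n-1}A\cdot s_\lambda\Big)\oplus A\cdot(a_r+a_n)\to K[\mathcal P_r]\to0.$$ 3. If $r=n-1\le m_1$: $$0\to\Big(\bigoplus_{\lambda=0,\ \lambda\ne1}^{m_n-1}A\cdot s_\lambda\Big)\oplus A\cdot(a_{n-1}+(q+\epsilon)a_n+d\,a_{n+1})\to K[\mathcal P_{n-1}]\to0,$$ with $\epsilon=1$ if $l=n-1$ and $\epsilon=0$ otherwise. 4. If $r=2$ and $m_1=1$: $$0\to\bigoplus_{\lambda\in\Lambda_2}A\cdot(s_\lambda+a_n+d\,a_{n+1})\to\Big(\bigoplus_{\lambda=0,\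 \lambda\notin\Lambda_2}^{m_n-1}A\cdot s_\lambda\Big)\oplus\Big(\bigoplus_{\lambda\in\Lambda_2}A\cdot(s_\lambda+a_n)\Big)\oplus\Big(\bigoplus_{\lambda\in\Lambda_2}A\cdot(s_\lambda+d\,a_{n+1})\Big)\to K[\mathcal P_2]\to0,$$ where $\Lambda_2:=\{\mu(n-1)-1\mid1\le\mu\le d\}$. 5. If $r\in\{3,\dots,n-2\}$ and $r>m_1$: $$0\to A\cdot(a_r+a_n+d\,a_{n+1})\to\Big(\bigoplus_{\lambda=0,\ \lambda\ne n-r}^{m_n-1}A\cdot s_\lambda\Big)\oplus A\cdot(a_r+a_n)\oplus A\cdot(a_r+d\,a_{n+1})\to K[\mathcal P_r]\to0.$$ 6. If $r=n-1>m_1$: $$0\to\Big(\bigoplus_{\lambda=0,\ \lambda\ne1}^{m_n-1}A\cdot s_\lambda\Big)\oplus A\cdot(a_{n-1}+d\,a_{n+1})\to K[\mathcal P_{n-1}]\to0.$$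
   Context: $K$ is an infinite field, $n\ge4$, and $m_1<\dots<m_n$ is an arithmetic sequence of relatively prime positive integers: $m_i=m_1+(i-1)d$ with $m_1,d\in\mathbb Z^+$ and $\gcd\{m_1,d\}=1$. Let $a_i=(m_i,m_n-m_i)\in\mathbb N^2$ for $1\le i\le n-1$, $a_n=(m_n,0)$, $a_{n+1}=(0,m_n)$. For $r\in\{2,\dots,n-1\}$, $\mathcal P_r\subset\mathbb N^2$ is the semigroup (with $0$) generated by $\{a_1,\dots,a_{n+1}\}\setminus\{a_r\}$ and $K[\mathcal P_r]=K[t^s\mid s\in\mathcal P_r]$. $A=K[x_n,x_{n+1}]$ is a Noether normalization of $K[\mathcal P_r]$ via $x_n\mapsto t^{a_n}$, $x_{n+1}\mapsto t^{a_{n+1}}$, multigraded by $\deg x_n=a_n$, $\deg x_{n+1}=a_{n+1}$. The multigraded Noether resolution of $K[\mathcal P_r]$ is its minimal multigraded free resolution as an $A$-module; $A\cdot s$ denotes the shift of $A$ by $s\in\mathbb N^2$ (free of rank one, generated in multidegree $s$). The statement describes the multigraded free modules in this resolution. *)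

(* Defs.v *)
From mathcomp Require Import all_boot all_order all_algebra.
From mathcomp.multinomials Require Import mpoly.

Set Implicit Arguments.
Unset Strict Implicit.
Unset Printing Implicit Defensive.

Import GRing.Theory.
Local Open Scope ring_scope.

Definition infinite_type (T : eqType) : Prop :=
  forall s : seq T, exists x : T, x \notin s.

(* The monoid N^2 is the monoid of exponents of bivariate monomials, so that
   t^s is 'X_[s] in K[t_1, t_2] = {mpoly K[2]}. *)
Notation N2 := ('X_{1..2}).
Definition pt (x y : nat) : N2 := [multinom of [:: x; y]].

Section MultigradedResolutions.

(* A = K[x, y] is also represented by {mpoly K[2]}, with x = 'X_0, y = 'X_1,
   deg x = b and deg y = c. *)
Variables (K : fieldType) (b c : N2).

Definition mdegree (m : 'X_{1..2}) : N2 := (b *+ m 0%R + c *+ m 1%R)%MM.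

(* \bigoplus_(s in S) A.s, the j-th basis vector having multidegree S_j. *)
Definition free_mod (S : seq N2) := 'rV[{mpoly K[2]}]_(size S).

Definition mgraded (S : seq N2) (t : N2) (v : free_mod S) : Prop :=
  forall (j : 'I_(size S)) (m : 'X_{1..2}),
    m \in msupp (v 0 j) -> (mdegree m + tnth (in_tuple S) j)%MM = t.

(* K[P], as a subset of K[t_1, t_2]. *)
Definition semigroup_ring (P : N2 -> Prop) (p : {mpoly K[2]}) : Prop :=
  forall s, s \in msupp p -> P s.

Definition mgraded_ring (t : N2) (p : {mpoly K[2]}) : Prop :=
  forall s, s \in msupp p -> s = t.

(* K[P] is an A-module via the morphism x |-> t^b, y |-> t^c, and there is a
   minimal multigraded free resolution of this A-module
     ... -> F_2 --del 1--> F_1 --del 0--> F_0 --eps--> K[P] -> 0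
   with F_i = \bigoplus_(s in nth [::] Ss i) A.s; F_i = 0 beyond Ss. *)
Definition noether_resolution (P : N2 -> Prop) (Ss : seq (seq N2)) : Prop :=
  let F i := nth [::] Ss i in
  exists (eps : {linear free_mod (F 0%N) -> {mpoly K[2]} |
                   comp_mpoly [tuple 'X_[b]; 'X_[c]] \; *%R})
         (del : forall i, {linear free_mod (F i.+1) -> free_mod (F i)}),
    [/\ (* multigraded of degree 0 *)
        (forall t v, mgraded t v -> mgraded_ring t (eps v)) /\
        (forall i t v, mgraded t v -> mgraded t (del i v)),
        (* exact *)
        forall p, semigroup_ring P p <-> exists v, eps v = p,
        forall v, eps v = 0 <-> exists w, del 0%N w = v,
        forall i v, del i v = 0 <-> exists w, del i.+1 w = v
      & (* minimal: del i maps into (x, y) F_i *)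
        forall i v, exists u w : free_mod (F i),
          del i v = 'X_0 *: u + 'X_1 *: w].

End MultigradedResolutions.

Section ArithmeticSequence.
Local Open Scope nat_scope.
Variables (m1 d n : nat).

Definition mseq (i : nat) : nat := m1 + (i - 1) * d.

Definition agen (i : nat) : N2 :=
  if i <= n then pt (mseq i) (mseq n - mseq i) else pt 0 (mseq n).

Definition Psemi (r : nat) (s : N2) : Prop :=
  exists k : nat -> nat,
    s = (\sum_(1 <= i < n.+2 | i != r) agen i *+ k i)%MM.

Definition ceil_div (x y : nat) : nat := (x + y - 1) %/ y.

(* The truncated subtraction is exact since mseq n >= (n - 1) * d. *)
Definition sdeg (la : nat) : N2 :=
  pt (ceil_div la (n - 1) * mseq n - la * d) (la * d).

Definition qpar : nat := (m1 - 1) %/ (n - 1).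
Definition lpar : nat := m1 - qpar * (n - 1).
Definition epar : nat := if lpar == n - 1 then 1 else 0.

Definition Lambda1 : seq nat :=
  [seq mu * (n - 1) - 1 | mu <- iota 1 (qpar + d + epar)].
Definition Lambda2 : seq nat := [seq mu * (n - 1) - 1 | mu <- iota 1 d].

Definition sdegs_except (L : seq nat) : seq N2 :=
  [seq sdeg la | la <- iota 0 (mseq n) & la \notin L].

End ArithmeticSequence.

(* Main.v *)
(* Write N = n - 1, M = m_n and c = n - r.  A point of N^2 is a sum of h of the
   generators a_1, ..., a_n and j copies of a_(n+1) exactly when it equals
   (h M - la d, la d + j M) with la a sum of h digits in {0, ..., N} (a_i has
   digit n - i); leaving out a_r forbids the digit c.  Only few sums get lost:
   la = c for one digit, N h - 1 when c = N - 1, and la = 1 when c = 1.  The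
   point also arises from la + u M, trading M units of la for d copies of
   a_(n+1), so that in each residue class la < M the elements of the semigroup
   form a translate of a monomial ideal of A, which turns out to be (1),
   (x_n^k), (x_n^k x_(n+1)^d) or (x_n, x_(n+1)^d).  The residue classes are
   distinguished by the second coordinate modulo M because d is prime to M.
   Hence K[P_r] is a direct sum of shifted monomial ideals of A, free in the
   first three cases and resolved by a Koszul complex in the last one. *)

Require Import Defs.
From mathcomp Require Import all_boot all_order all_algebra.
From mathcomp.multinomials Require Import mpoly.
From HB Require Import structures.
From mathcomp Require Import zify ring.

Set Implicit Arguments.
Unset Strict Implicit.
Unset Printing Implicit Defensive.

Import GRing.Theory.

(** * Graded free modules mapping onto K[P], and resolutions of length zero *)

Section Augmentation.
Local Open Scope ring_scope.
Variables (K : fieldType) (b c : N2).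
Local Notation phi := (comp_mpoly [tuple 'X_[b] : {mpoly K[2]}; 'X_[c]]).
Local Notation mdeg := (mdegree b c).

Lemma mdegreeD m m' : mdeg (m + m') = (mdeg m + mdeg m')%MM.
Proof.
apply/mnmP => i; rewrite /mdegree !(mnmDE, mulmnE) !mulnDr.
by rewrite addnACA.
Qed.

Lemma mdegreeU0 : mdeg U_(0) = b.
Proof. by apply/mnmP => i; rewrite /mdegree !(mnmDE, mulmnE, mnm1E) muln1 muln0 addn0. Qed.

Lemma mdegreeU1 : mdeg U_(1) = c.
Proof. by apply/mnmP => i; rewrite /mdegree !(mnmDE, mulmnE, mnm1E) muln1 muln0. Qed.

Lemma mdegreeMn m k : mdeg (m *+ k)%MM = (mdeg m *+ k)%MM.
Proof.
apply/mnmP => i.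
by rewrite /mdegree !(mnmDE, mulmnE) mulnDl !mulnA.
Qed.

Lemma comp_mpoly_mdegree m : phi 'X_[m] = 'X_[mdeg m].
Proof.
rewrite comp_mpolyX 2!big_ord_recl big_ord0 mulr1 /mdegree mpolyXD -!mpolyXn.
by congr (_ ^+ _ * _ ^+ m _); apply: val_inj.
Qed.

Lemma mcoeff_comp_mdegree p s t :
  (phi p * 'X_[s])@_t =
    \sum_(m <- msupp p) p@_m *+ ((mdeg m + s)%MM == t).
Proof.
rewrite comp_mpolyEX mulr_suml raddf_sum /=; apply: eq_bigr => m _.
rewrite comp_mpoly_mdegree -scalerAl -mpolyXD mcoeffZ mcoeffX.
by rewrite mulr_natr.
Qed.

Definition augmentation (S : seq N2) (v : free_mod K S) : {mpoly K[2]} :=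
  \sum_(j < size S) phi (v 0 j) * 'X_[tnth (in_tuple S) j].

Fact augmentation_is_linear S :
  GRing.linear_for (phi \; *%R) (@augmentation S).
Proof.
move=> a u v; rewrite /augmentation /= mulr_sumr -big_split /=.
by apply: eq_bigr => j _; rewrite !mxE rmorphD rmorphM mulrDl mulrA.
Qed.

HB.instance Definition _ S :=
  GRing.isLinear.Build {mpoly K[2]} (free_mod K S) {mpoly K[2]} (phi \; *%R)
    (@augmentation S) (@augmentation_is_linear S).

Lemma mcoeff_augmentation S (v : free_mod K S) t :
  (augmentation v)@_t = \sum_(j < size S) \sum_(m <- msupp (v 0 j))
    (v 0 j)@_m *+ ((mdeg m + tnth (in_tuple S) j)%MM == t).
Proof.
by rewrite raddf_sum; apply: eq_bigr => j _; rewrite /= mcoeff_comp_mdegree.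
Qed.

Lemma msupp_augmentation S (v : free_mod K S) t :
  t \in msupp (augmentation v) ->
  exists j, exists2 m, m \in msupp (v 0 j) &
    (mdeg m + tnth (in_tuple S) j)%MM = t.
Proof.
rewrite mcoeff_msupp => nz.
have [/existsP[j /hasP[m mv /eqP e]]|none] := boolP [exists j, has
    (fun m => (mdeg m + tnth (in_tuple S) j)%MM == t) (msupp (v 0 j))].
  by exists j, m.
case/eqP: nz; rewrite mcoeff_augmentation big1 // => j _.
rewrite big1_seq // => m /andP[_ mv].
case: eqP => // e; case/existsP: none; exists j; apply/hasP.
by exists m => //; apply/eqP.
Qed.

Lemma augmentation_graded S t (v : free_mod K S) :
  mgraded b c t v -> mgraded_ring t (augmentation v).
Proof. by move=> vt s /msupp_augmentation[j [m /vt <- <-]]. Qed.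

(** Surjectivity onto K[P] is a question about exponents only, since the image is spanned by the
    monomials t^([mdeg m] + g) with g in [S]. *)
Lemma augmentation_image S (P : N2 -> Prop) :
  (forall s, P s <-> exists2 g, g \in S & exists m, s = (mdeg m + g)%MM) ->
  forall p, semigroup_ring P p <-> exists v : free_mod K S, augmentation v = p.
Proof.
move=> PE p; split=> [pP | [v <-] s /msupp_augmentation[j [m mv <-]]]; last first.
  by apply/PE; exists (tnth (in_tuple S) j); [exact: mem_tnth | exists m].
have monomial s a : P s -> exists v : free_mod K S, augmentation v = a *: 'X_[s].
  move=> /PE[g gS [m ->]]; have gi : (index g S < size S)%N by rewrite index_mem.
  exists (\row_k ((k == Ordinal gi)%:R * (a *: 'X_[m]))).
  rewrite /augmentation (bigD1 (Ordinal gi)) //= [X in _ + X]big1 ?addr0.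
    rewrite mxE (eqxx (Ordinal gi)) mul1r linearZ /= comp_mpoly_mdegree -scalerAl -mpolyXD.
    by rewrite (tnth_nth 0%MM) /= nth_index.
  by move=> i /negPf iN; rewrite mxE iN mul0r rmorph0 mul0r.
rewrite [p]mpolyE big_seq; elim/big_ind: _ => [|_ _ [u <-] [v <-]|s sp].
- by exists 0; rewrite linear0.
- by exists (u + v); rewrite linearD.
- exact: monomial (pP s sp).
Qed.

(** The invariant [cl] does not change under multiplication by A and separates the basis degrees, so
    distinct coordinates contribute disjoint sets of monomials; within one coordinate, injectivity
    of [mdeg] prevents cancellation. Hence every coefficient of [v] can be read off its image. *)
Lemma augmentation_injective (cl : N2 -> nat) S :
    injective mdeg -> (forall m s, cl (mdeg m + s)%MM = cl s) ->
    uniq (map cl S) ->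
  forall v : free_mod K S, augmentation v = 0 -> v = 0.
Proof.
move=> inj_mdeg clE uS v v0; apply/rowP => j; rewrite mxE; apply/mpolyP => m.
set sj := tnth (in_tuple S) j.
have /(congr1 (mcoeff (mdeg m + sj)%MM)) := v0.
rewrite mcoeff_augmentation mcoeff0 (bigD1 j) //= [X in _ + X]big1 ?addr0.
  rewrite mcoeff0 => <-; have [ms|] := boolP (m \in msupp (v 0 j)); last first.
    move=> ms; rewrite big1_seq ?memN_msupp_eq0 // => m' /andP[_ m's].
    rewrite (inj_eq (@addIm _ _)) (inj_eq inj_mdeg).
    by case: eqP m's => // ->; rewrite (negPf ms).
  rewrite (bigD1_seq m) ?msupp_uniq //= eqxx big1 ?addr0 // => m' /negPf m'm.
  by rewrite (inj_eq (@addIm _ _)) (inj_eq inj_mdeg) m'm.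
move=> i /negPf ij; rewrite big1 // => m' _; case: eqP => // /(congr1 cl).
rewrite !clE /sj !(tnth_nth 0%MM) /= => e.
have := nth_uniq 0%N _ _ uS; rewrite size_map => /(_ i j).
by rewrite !(nth_map 0%MM) // e eqxx => /(_ (ltn_ord i) (ltn_ord j)); rewrite [RHS]ij.
Qed.

(** This is regularity of the sequence x, y^k. From p x = - q y^k, the x-free monomials of q have
    coefficient 0, so x divides q; then x cancels. *)
Lemma pair_syzygy (p q : {mpoly K[2]}) k :
  p * 'X_0 + q * 'X_[U_(1) *+ k] = 0 ->
  exists w, p = w * 'X_[U_(1) *+ k] /\ q = - (w * 'X_0).
Proof.
move=> pq0; have pE : p * 'X_0 = - q * 'X_[U_(1) *+ k].
  by rewrite mulNr; apply/eqP; rewrite -subr_eq0 opprK pq0.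
have q0 (m : 'X_{1..2}) : m 0 = 0%N -> q@_m = 0.
  move=> m0; rewrite -(mcoeffMX q (U_(1) *+ k)%MM) -[_@_ _]opprK -mcoeffN -mulNr -pE.
  suff -> : (p * 'X_0)@_(U_(1) *+ k + m) = 0 by rewrite oppr0.
  apply: memN_msupp_eq0; rewrite (perm_mem (msuppMX _ _)).
  apply/mapP => -[m' _ /(congr1 (fun m : 'X_{1..2} => m 0))].
  by rewrite !(mnmDE, mulmnE, mnm1E) m0.
(* This is - q / x, divided term by term; the subtraction of exponents is exact because each m in
   the support of q contains x. *)
pose w := \sum_(m <- msupp q) - (q@_m *: 'X_[m - U_(0)]).
have qE : q = - (w * 'X_0).
  rewrite {1}[q]mpolyE mulr_suml -sumrN big_seq [RHS]big_seq.
  apply: eq_bigr => m mq; rewrite mulNr opprK -scalerAl -mpolyXD submK //.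
  apply/mnm_lepP => i; rewrite mnm1E; case: eqP => // <-.
  by rewrite lt0n; apply: contraTneq mq => /q0/eqP; rewrite -mcoeff_eq0.
exists w; split=> //; apply: (@mulIf _ 'X_0); first by rewrite -msupp_eq0 msuppX.
by rewrite pE qE opprK -!mulrA [X in _ * X]mulrC.
Qed.

Lemma one_step_resolution (cl : N2 -> nat) (S : seq N2) (P : N2 -> Prop) :
    injective mdeg -> (forall m s, cl (mdeg m + s)%MM = cl s) ->
    uniq (map cl S) ->
    (forall s, P s <-> exists2 g, g \in S & exists m, s = (mdeg m + g)%MM) ->
  noether_resolution K b c P [:: S].
Proof.
move=> inj_mdeg clE uS PE.
exists (@augmentation S); exists (fun=> \0).
(* Past the end of the list, [nth] returns the empty list of degrees, and row vectors of width 0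
   vanish. *)
have nil0 i (v : free_mod K (nth [::] [:: S] i.+1)) : v = 0.
  case: i v => [|i] v; apply/rowP=> -[j j0]; exfalso; by rewrite /= ?nth_nil in j0.
split.
- by split=> [t v /augmentation_graded|i t v _ j m] //; rewrite mxE msupp0.
- exact: augmentation_image.
- move=> v; split=> [/(augmentation_injective inj_mdeg clE uS) ->|[w <-]].
    by exists 0.
  exact: linear0.
- by move=> i v; split=> [_|//]; exists 0; rewrite [RHS]nil0.
- by move=> i v; exists 0, 0; rewrite !scaler0 addr0.
Qed.

(* Indexing by nat, with junk value 0 beyond size S, avoids casts between the
   ordinals of the concatenated lists of degrees. *)
Definition coord S (v : free_mod K S) (k : nat) : {mpoly K[2]} :=
  oapp (v 0) 0 (insub k).

Lemma coord_ord S (v : free_mod K S) (j : 'I_(size S)) : coord v j = v 0 j.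
Proof. by rewrite /coord valK. Qed.

Lemma coordP S (u v : free_mod K S) :
  (forall k, (k < size S)%N -> coord u k = coord v k) -> u = v.
Proof. by move=> uv; apply/rowP => j; rewrite -!coord_ord uv. Qed.

Lemma coord0 S k : coord (0 : free_mod K S) k = 0.
Proof. by rewrite /coord; case: insubP => [j _ _|] //=; rewrite mxE. Qed.

Lemma coord_linear S a (u v : free_mod K S) k :
  coord (a *: u + v) k = a * coord u k + coord v k.
Proof.
by rewrite /coord; case: insubP => [j _ _|] /=; rewrite ?mxE ?mulr0 ?addr0.
Qed.

Lemma augmentation_coord S (v : free_mod K S) :
  augmentation v = \sum_(0 <= k < size S) phi (coord v k) * 'X_[nth 0%MM S k].
Proof.
by rewrite big_mkord; apply: eq_bigr => j _; rewrite coord_ord (tnth_nth 0%MM).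
Qed.

(** * Resolutions of length one: a Koszul relation for each copy of the ideal (x, y^k) *)

Section TwoSteps.
Variables (S L : seq N2) (k : nat).

Definition gens : seq N2 :=
  S ++ [seq (s + b)%MM | s <- L] ++ [seq (s + c *+ k)%MM | s <- L].
Definition syzs : seq N2 := [seq (s + b + c *+ k)%MM | s <- L].

Lemma size_gens : size gens = (size S + size L + size L)%N.
Proof. by rewrite !size_cat !size_map addnA. Qed.

Lemma size_syzs : size syzs = size L.
Proof. exact: size_map. Qed.

(** Direct sum over [L] of the Koszul maps 1 |-> (y^k, -x); the three branches are the three blocks
    of [gens]. *)
Definition syzygy (w : free_mod K syzs) : free_mod K gens :=
  \row_(j < size gens)
    if (j < size S)%N then 0
    else if (j < size S + size L)%N then
      coord w (j - size S) * 'X_[U_(1) *+ k]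
    else - (coord w (j - (size S + size L)) * 'X_0).

Fact syzygy_is_linear : linear syzygy.
Proof.
move=> a u v; apply/rowP => j; rewrite !mxE; case: ifP => _; last case: ifP => _.
- by rewrite mulr0 addr0.
- by rewrite coord_linear mulrDl mulrA.
- by rewrite coord_linear mulrDl opprD mulrN mulrA.
Qed.

HB.instance Definition _ :=
  GRing.isLinear.Build {mpoly K[2]} (free_mod K syzs) (free_mod K gens) *:%R
    syzygy syzygy_is_linear.

(* Each pair of generators of degrees s + b and s + k c is replaced by a single
   generator of degree s, whose multiples by x and y^k they are. *)
Definition fold_pairs (v : free_mod K gens) : free_mod K (S ++ L) :=
  \row_(j < size (S ++ L))
    if (j < size S)%N then coord v j
    else coord v j * 'X_0 + coord v (j + size L) * 'X_[U_(1) *+ k].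

Lemma gens_index_case (Q : nat -> Prop) :
    (forall j, (j < size S)%N -> Q j) ->
    (forall j, (j < size L)%N -> Q (size S + j)%N) ->
    (forall j, (j < size L)%N -> Q (size S + size L + j)%N) ->
  forall j, (j < size gens)%N -> Q j.
Proof.
move=> Q1 Q2 Q3 j; rewrite size_gens; have [/Q1|Sj] // := ltnP j (size S).
have [|SLj jl] := ltnP j (size S + size L); rewrite -(subnKC Sj).
  by rewrite ltn_add2l => /Q2.
by rewrite (subnKC Sj) -(subnKC SLj); apply: Q3; rewrite ltn_subLR.
Qed.

Lemma coord_syzygy1 w j : (j < size S)%N -> coord (syzygy w) j = 0.
Proof.
move=> jS; have jg : (j < size gens)%N by rewrite size_gens -addnA ltn_addr.
by rewrite (coord_ord _ (Ordinal jg)) mxE /= jS.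
Qed.

Lemma coord_syzygy2 w j : (j < size L)%N ->
  coord (syzygy w) (size S + j) = coord w j * 'X_[U_(1) *+ k].
Proof.
move=> jL; have jg : (size S + j < size gens)%N.
  by rewrite size_gens -addnA ltn_add2l ltn_addr.
rewrite (coord_ord _ (Ordinal jg)) mxE /= ltn_add2l jL ltnNge leq_addr /=.
by rewrite addKn.
Qed.

Lemma coord_syzygy3 w j : (j < size L)%N ->
  coord (syzygy w) (size S + size L + j) = - (coord w j * 'X_0).
Proof.
move=> jL; have jg : (size S + size L + j < size gens)%N.
  by rewrite size_gens ltn_add2l.
by rewrite (coord_ord _ (Ordinal jg)) mxE /= addKn !ltnNge leq_addr -addnA leq_addr.
Qed.

Lemma coord_fold_pairs1 v j :
  (j < size S)%N -> coord (fold_pairs v) j = coord v j.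
Proof.
move=> jS; have jg : (j < size (S ++ L))%N by rewrite size_cat ltn_addr.
by rewrite (coord_ord _ (Ordinal jg)) mxE /= jS.
Qed.

Lemma coord_fold_pairs2 v j : (j < size L)%N ->
  coord (fold_pairs v) (size S + j) = coord v (size S + j) * 'X_0 +
    coord v (size S + size L + j) * 'X_[U_(1) *+ k].
Proof.
move=> jL; have jg : (size S + j < size (S ++ L))%N by rewrite size_cat ltn_add2l.
by rewrite (coord_ord _ (Ordinal jg)) mxE /= ltnNge leq_addr /= addnAC.
Qed.

Lemma nth_gens1 j : (j < size S)%N -> nth 0%MM gens j = nth 0%MM S j.
Proof. by move=> jS; rewrite nth_cat jS. Qed.

Lemma nth_gens2 j : (j < size L)%N ->
  nth 0%MM gens (size S + j) = (nth 0%MM L j + b)%MM.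
Proof.
move=> jL; rewrite nth_cat ltnNge leq_addr /= addKn nth_cat size_map jL.
exact: nth_map.
Qed.

Lemma nth_gens3 j : (j < size L)%N ->
  nth 0%MM gens (size S + size L + j) = (nth 0%MM L j + c *+ k)%MM.
Proof.
move=> jL; rewrite nth_cat -addnA ltnNge leq_addr /= addKn nth_cat size_map.
by rewrite ltnNge leq_addr /= addKn (nth_map 0%MM).
Qed.

(** The augmentation on [gens] thus factors through the one on [S ++ L], which is injective when the
    classes are distinct, so its kernel is that of [fold_pairs]. *)
Lemma augmentation_fold_pairs v : augmentation (fold_pairs v) = augmentation v.
Proof.
rewrite !augmentation_coord size_cat size_gens !big_mkord !big_split_ord /= -addrA.
congr (_ + _).
  apply: eq_bigr => j _.
  by rewrite coord_fold_pairs1 // nth_gens1 // nth_cat ltn_ord.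
rewrite -big_split /=; apply: eq_bigr => j _.
rewrite coord_fold_pairs2 // nth_cat ltnNge leq_addr /=.
rewrite addKn nth_gens2 // nth_gens3 // rmorphD !rmorphM /= !comp_mpoly_mdegree.
rewrite mdegreeU0 mdegreeMn mdegreeU1 mulrDl -!mulrA -!mpolyXD.
by rewrite ![(_ + nth 0%MM L j)%MM]addmC.
Qed.

Lemma fold_pairs_eq0 v : fold_pairs v = 0 <-> exists w, syzygy w = v.
Proof.
split=> [v0|[w <-]]; last first.
  apply: coordP => j; rewrite coord0 size_cat.
  have [jS _|Sj] := ltnP j (size S); first by rewrite coord_fold_pairs1 // coord_syzygy1.
  rewrite -(subnKC Sj) ltn_add2l => jL.
  rewrite coord_fold_pairs2 // coord_syzygy2 // coord_syzygy3 // mulNr.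
  by rewrite -!mulrA [X in _ * X]mulrC subrr.
have /fin_all_exists[w wP] (j : 'I_(size L)) : exists w : {mpoly K[2]},
    coord v (size S + j) = w * 'X_[U_(1) *+ k] /\
    coord v (size S + size L + j) = - (w * 'X_0).
  by apply: pair_syzygy; rewrite -coord_fold_pairs2 // v0 coord0.
exists (\row_(j < size syzs) w (cast_ord size_syzs j)).
have wE j (jL : (j < size L)%N) :
    coord (\row_(j < size syzs) w (cast_ord size_syzs j) : free_mod K syzs) j =
    w (Ordinal jL).
  have jz : (j < size syzs)%N by rewrite size_syzs.
  by rewrite (coord_ord _ (Ordinal jz)) mxE; congr w; apply: val_inj.
apply: coordP; apply: gens_index_case => j jl.
- by rewrite coord_syzygy1 // -coord_fold_pairs1 // v0 coord0.
- by rewrite coord_syzygy2 // wE (wP (Ordinal jl)).1.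
- by rewrite coord_syzygy3 // wE (wP (Ordinal jl)).2.
Qed.

Lemma mgraded_coord Z t (v : free_mod K Z) : mgraded b c t v <->
  forall j, (j < size Z)%N -> forall m, m \in msupp (coord v j) ->
    (mdeg m + nth 0%MM Z j)%MM = t.
Proof.
split=> [vt j jZ m|vt j m].
  by rewrite (coord_ord _ (Ordinal jZ)) => /vt; rewrite (tnth_nth 0%MM).
by rewrite -coord_ord => /vt; rewrite (tnth_nth 0%MM); apply.
Qed.

Lemma syzygy_graded t w : mgraded b c t w -> mgraded b c t (syzygy w).
Proof.
move/mgraded_coord => wt; apply/mgraded_coord; apply: gens_index_case => j jl m.
- by rewrite coord_syzygy1 // msupp0.
- rewrite coord_syzygy2 // nth_gens2 // (perm_mem (msuppMX _ _)).
  case/mapP=> m' /wt; rewrite size_syzs (nth_map 0%MM) // => <- // ->.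
  by rewrite mdegreeD mdegreeMn mdegreeU1; apply/mnmP => i; rewrite !mnmDE; ring.
- rewrite coord_syzygy3 // nth_gens3 // (perm_mem (msuppN _)) (perm_mem (msuppMX _ _)).
  case/mapP=> m' /wt; rewrite size_syzs (nth_map 0%MM) // => <- // ->.
  by rewrite mdegreeD mdegreeU0; apply/mnmP => i; rewrite !mnmDE; ring.
Qed.

(** The entries of the Koszul map are y^k and -x; positivity of [k] allows one factor y to be taken
    out of y^k. *)
Lemma syzygy_minimal w : (0 < k)%N ->
  exists u u' : free_mod K gens, syzygy w = 'X_0 *: u + 'X_1 *: u'.
Proof.
move=> k0.
exists (\row_(j < size gens) if (j < size S + size L)%N then 0
  else - coord w (j - (size S + size L))).
exists (\row_(j < size gens) if (j < size S)%N then 0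
  else if (j < size S + size L)%N
    then coord w (j - size S) * 'X_[U_(1) *+ k.-1] else 0).
apply/rowP => j; rewrite !mxE.
have [jS|Sj] := ltnP j (size S); first by rewrite ltn_addr // !mulr0 addr0.
case: ifP => _; last by rewrite !mulr0 addr0 mulrN mulrC.
rewrite mulr0 add0r mulrCA -mpolyXD; congr (_ * 'X_[_]).
by rewrite -{1}(prednK k0) mulmS.
Qed.

Lemma syzygy_injective w : syzygy w = 0 -> w = 0.
Proof.
move=> w0; apply: coordP => j; rewrite coord0 size_syzs => jL.
have := coord_syzygy3 w jL; rewrite w0 coord0 => /esym/eqP.
rewrite oppr_eq0 mulf_eq0 -[X in _ || X]msupp_eq0 msuppX orbF.
by move/eqP.
Qed.

(** Matching on [i] lets the dependent type reduce to that of [syzygy] at 0; all later maps start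
    from the zero module. *)
Definition two_step_del i :
    {linear free_mod K (nth [::] [:: gens; syzs] i.+1) ->
      free_mod K (nth [::] [:: gens; syzs] i)} :=
  if i is 0 then (syzygy : {linear _ -> _}) else \0.

Lemma two_step_resolution (cl : N2 -> nat) (P : N2 -> Prop) :
    injective mdeg -> (forall m s, cl (mdeg m + s)%MM = cl s) ->
    uniq (map cl (S ++ L)) -> (0 < k)%N ->
    (forall s, P s <-> exists2 g, g \in gens & exists m, s = (mdeg m + g)%MM) ->
  noether_resolution K b c P [:: gens; syzs].
Proof.
move=> inj_mdeg clE uS k0 PE.
exists (@augmentation gens); exists two_step_del.
have nil0 i (v : free_mod K (nth [::] [:: gens; syzs] i.+2)) : v = 0.
  by apply/rowP=> -[j j0]; exfalso; rewrite /= nth_nil in j0.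
split.
- split=> [t v /augmentation_graded //|[|i] t v].
    exact: syzygy_graded.
  by move=> _ j m; rewrite mxE msupp0.
- exact: augmentation_image.
- move=> /= v; rewrite -fold_pairs_eq0 -augmentation_fold_pairs; split=> [|->].
    exact: (augmentation_injective inj_mdeg clE uS).
  exact: linear0.
- move=> [|i] v; split=> [v0|[w <-]]; try by exists 0; rewrite [RHS]nil0.
    by exists 0; rewrite /= (syzygy_injective v0).
    by rewrite [w]nil0 linear0.
  by [].
- move=> [|i] v; first exact: syzygy_minimal.
  by exists 0, 0; rewrite !scaler0 addr0.
Qed.

End TwoSteps.

End Augmentation.

(** * Coordinates (la, H, J) on the points of N^2, and residue classes *)

Section ArithmeticSemigroup.
Local Open Scope nat_scope.
Variables n m1 d : nat.
Local Notation M := (mseq m1 d n).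
Local Notation N := (n - 1).
Local Notation a := (agen m1 d n).
Local Notation s_ := (sdeg m1 d n).
Local Notation mdeg := (mdegree (a n) (a n.+1)).

Lemma pt0 x y : pt x y 0%R = x. Proof. by []. Qed.

Lemma pt1 x y : pt x y 1%R = y. Proof. by []. Qed.

Lemma mseqE : M = m1 + N * d. Proof. by []. Qed.

Lemma mnm2P (s t : N2) : s 0%R = t 0%R -> s 1%R = t 1%R -> s = t.
Proof.
move=> e0 e1; apply/mnmP => i.
by case: i => [[|[|i]] lti] //; [move: e0 | move: e1]; congr (s _ = t _);
  apply: val_inj.
Qed.

Lemma mdeg0 m : mdeg m 0%R = m 0%R * M.
Proof.
by rewrite /mdegree /agen leqnn ltnn !(mnmDE, mulmnE) !pt0 mul0n addn0 mulnC.
Qed.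

Lemma mdeg1 m : mdeg m 1%R = m 1%R * M.
Proof.
by rewrite /mdegree /agen leqnn ltnn subnn !(mnmDE, mulmnE) !pt1 mul0n mulnC.
Qed.

(* s = (H M - la d, la d + J M), without truncated subtraction. *)
Definition rep (s : N2) (la H J : nat) : Prop :=
  s 0%R + la * d = H * M /\ s 1%R = la * d + J * M.

Definition residue (s : N2) : nat := s 1%R %% M.

Lemma residue_mdegD m s : residue (mdeg m + s)%MM = residue s.
Proof. by rewrite /residue mnmDE mdeg1 modnMDl. Qed.

Lemma residue_rep s la H J : rep s la H J -> residue s = la * d %% M.
Proof. by case=> _ s1; rewrite /residue s1 addnC modnMDl. Qed.

Lemma rep_inj s t la H J : rep s la H J -> rep t la H J -> s = t.
Proof.
move=> [s0 s1] [t0 t1]; apply: mnm2P; last by rewrite s1 t1.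
by apply/eqP; rewrite -(eqn_add2r (la * d)) s0 t0.
Qed.

Lemma rep0 : rep 0%MM 0 0 0.
Proof. by split; rewrite mnm0E. Qed.

Lemma rep_add s t la H J la' H' J' : rep s la H J -> rep t la' H' J' ->
  rep (s + t)%MM (la + la') (H + H') (J + J').
Proof. by move=> [s0 s1] [t0 t1]; split; rewrite mnmDE ?s1 ?t1; lia. Qed.

Lemma rep_mul s la H J k : rep s la H J -> rep (s *+ k)%MM (la * k) (H * k) (J * k).
Proof. by move=> [s0 s1]; split; rewrite mulmnE; nia. Qed.

(** The product (u M) d is also (u d) M, so it can be absorbed as u d units of H or of J. *)
Lemma rep_shift u s la H J :
  rep s (la + u * M) (H + u * d) J <-> rep s la H (J + u * d).
Proof. by split=> -[s0 s1]; split; nia. Qed.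

Lemma rep_agen i : 0 < i <= n -> rep (a i) (n - i) 1 0.
Proof.
move=> /andP[i0 ile]; rewrite /agen ile; split; rewrite ?pt0 ?pt1 /mseq; last by nia.
have -> : n - 1 = (i - 1) + (n - i) by lia.
by rewrite mulnDl; lia.
Qed.

Lemma rep_agenS : rep (a n.+1) 0 0 1.
Proof. by rewrite /agen ltnn; split; rewrite ?pt0 ?pt1 //; lia. Qed.

(** With [la] fixed, x raises H by one and y raises J by one, so divisibility by monomials of A
    becomes a pair of inequalities. *)
Lemma rep_above g la H0 J0 s : rep g la H0 J0 ->
  (exists m, s = (mdeg m + g)%MM) <->
  exists H J, [/\ H0 <= H, J0 <= J & rep s la H J].
Proof.
move=> gr; split=> [[m ->]|[H [J [leH leJ sr]]]].
  exists (m 0%R + H0), (m 1%R + J0); rewrite !leq_addl; split=> //.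
  by case: gr => g0 g1; split; rewrite mnmDE ?mdeg0 ?mdeg1; nia.
exists (pt (H - H0) (J - J0)); apply: rep_inj sr _.
by case: gr => g0 g1; split; rewrite mnmDE ?mdeg0 ?mdeg1 ?pt0 ?pt1; nia.
Qed.

Hypotheses (n_ge4 : 4 <= n) (m1_gt0 : 0 < m1).

Lemma rep_an : rep (a n) 0 1 0.
Proof. by have := @rep_agen n; rewrite subnn; apply; lia. Qed.

Lemma mseq_gt0 : 0 < M.
Proof. by rewrite mseqE addn_gt0 m1_gt0. Qed.

Lemma mdeg_inj : injective mdeg.
Proof.
have inj x y : x * M = y * M -> x = y.
  by move/eqP; rewrite eqn_pmul2r ?mseq_gt0 // => /eqP.
by move=> u v uv; apply: mnm2P; apply: inj; rewrite -?mdeg0 -?mdeg1 uv.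
Qed.

Lemma rep_ex la H J : la <= H * N -> exists s, rep s la H J.
Proof.
move=> laH; exists (pt (H * M - la * d) (la * d + J * M)); split=> //.
by rewrite pt0 subnK // mseqE; nia.
Qed.

Lemma ceil_div_le la H : (ceil_div la N <= H) = (la <= H * N).
Proof.
by rewrite /ceil_div -ltnS ltn_divLR; lia.
Qed.

Lemma rep_sdeg la : rep (s_ la) la (ceil_div la N) 0.
Proof.
have le : la <= ceil_div la N * N by rewrite -ceil_div_le.
by rewrite /sdeg; split; rewrite ?pt0 ?pt1 // ?addn0 // subnK // mseqE; nia.
Qed.

(** Dividing m1 - 1 rather than m1 puts the remainder l in 1..N instead of 0..N-1. *)
Lemma qlpar : [/\ m1 = qpar m1 n * N + lpar m1 n, 0 < lpar m1 n <= N &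
  epar m1 n = (lpar m1 n == N)].
Proof.
have N0 : 0 < N by lia.
have := divn_eq (m1 - 1) N; have := ltn_pmod (m1 - 1) N0.
rewrite /epar; have -> : forall x : bool, (if x then 1 else 0) = x by case.
rewrite /lpar /qpar; split=> //; lia.
Qed.

(** Since M = (q + d) N + l with 1 <= l <= N, the bound mu N <= M means mu <= q + d, or mu <= q + d
    + 1 when l = N. *)
Lemma mem_Lambda1 la : la \in Lambda1 m1 d n <->
  la < M /\ exists2 mu, 0 < mu & la.+1 = mu * N.
Proof.
have [m1E lb eE] := qlpar; rewrite /Lambda1 eE mseqE.
move: (qpar m1 n) (lpar m1 n) m1E lb => q l {eE} m1E lb.
split=> [/mapP[mu]|[laM [mu mu0 laE]]].
  rewrite mem_iota => mub ->; split; last by exists mu; nia.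
  by move: mub; case: eqP => [e|ne] mub; nia.
apply/mapP; exists mu; last by lia.
rewrite mem_iota mu0 /= add1n ltnS leqNgt; apply/negP.
by case: eqP => [e|ne] mub; nia.
Qed.

Lemma uniq_Lambda1 : uniq (Lambda1 m1 d n).
Proof.
rewrite map_inj_in_uniq ?iota_uniq // => x y; rewrite !mem_iota => /andP[x1 _] /andP[y1 _].
move=> e; apply/eqP; rewrite -(@eqn_pmul2r N); last lia.
nia.
Qed.

(** For m1 = 1 one has q = 0 and l = 1 < N, so q + d + epsilon is d. *)
Lemma Lambda2E : m1 = 1 -> Lambda2 d n = Lambda1 m1 d n.
Proof.
have [m1E lb eE] := qlpar => m11; rewrite /Lambda1 /Lambda2 eE.
congr [seq _ | _ <- iota 1 _]; nia.
Qed.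

Lemma ceil_div_Lambda1 la mu : la.+1 = mu * N -> ceil_div la N = mu.
Proof.
move=> e; apply/eqP; rewrite eqn_leq ceil_div_le -e leqnSn /=.
rewrite leqNgt; apply/negP => lt.
have : ceil_div la N <= mu.-1 by lia.
by rewrite ceil_div_le; nia.
Qed.

(** Origin of the exponent q + epsilon for r = n - 1: for m1 = q N + l, the factor q + 1 suffices
    unless l = N. *)
Lemma mul_gt_m1 H : (m1 < H * N) = (qpar m1 n + epar m1 n < H).
Proof.
have [m1E lb ->] := qlpar.
move: (qpar m1 n) (lpar m1 n) m1E lb => q l m1E lb.
rewrite m1E; apply/idP/idP; case: eqP => [e|ne] /=; nia.
Qed.

Lemma Lambda1_lt : {in Lambda1 m1 d n, forall la, la < M}.
Proof. by move=> la /mem_Lambda1[]. Qed.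

Hypothesis m1d : coprime m1 d.

(** M = m1 + N d is prime to d because m1 is, so d can be cancelled modulo M. *)
Lemma residue_inj la la' : la < M -> la' < M ->
  la * d = la' * d %[mod M] -> la = la'.
Proof.
have dM : coprime M d.
  by rewrite mseqE coprime_sym /coprime addnC gcdnMDl gcdnC; exact: m1d.
wlog le : la la' / la <= la' => [wl|laM laM' /esym/eqP].
  by case/orP: (leq_total la la') => /wl // w l1 l2 /esym e; rewrite (w l2 l1 e).
rewrite eqn_mod_dvd ?leq_mul2r ?le ?orbT // -mulnBl Gauss_dvdl // => dv.
apply/eqP; rewrite eqn_leq le -subn_eq0 /=.
by apply: contraLR dv => nz; rewrite gtnNdvd ?lt0n // (leq_ltn_trans (leq_subr _ _)).
Qed.

Lemma uniq_residues (L : seq nat) (f : nat -> N2) :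
    uniq L -> {in L, forall la, la < M} ->
    {in L, forall la, exists H J, rep (f la) la H J} ->
  uniq (map residue (sdegs_except m1 d n L ++ map f L)).
Proof.
move=> uL LM fr; rewrite map_cat -!map_comp.
rewrite (@eq_in_map _ _ (residue \o f) (fun la => la * d %% M) L).1; last first.
  by move=> la /fr[H [J /residue_rep]].
rewrite (@eq_map _ _ (residue \o s_) (fun la => la * d %% M)); last first.
  by move=> la; exact: residue_rep (rep_sdeg la).
rewrite -map_cat map_inj_in_uniq; last first.
  move=> x y; rewrite !mem_cat !mem_filter !mem_iota /= => xM yM.
  by apply: residue_inj; [case/orP: xM|case/orP: yM]; do ?[case/andP | move/LM].
rewrite cat_uniq filter_uniq ?iota_uniq // uL andbT.
by apply/hasPn => x xL; rewrite mem_filter xL.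
Qed.

(** * Digit sums avoiding n - r, and membership in P_r *)

Hypothesis d_gt0 : 0 < d.
Variable r : nat.
Hypothesis r_bnd : 2 <= r <= N.

(* For la <= h N: la is not a sum of h elements of {0, ..., N} \ {n - r}. *)
Definition gap (h la : nat) : bool :=
  let c := n - r in
  [|| (h == 1) && (la == c), (c == N - 1) && (la.+1 == h * N) |
      (c == 1) && (la == 1)].

(** With both h, h' positive, the first clause of [gap] fails for the sum. If the sum is one below
    its maximum, one summand is maximal and the other one below its own maximum; if the sum is 1,
    one summand is 1. Either way a summand was already a gap. *)
Lemma gap_add h la h' la' : la <= h * N -> la' <= h' * N ->
  ~~ gap h la -> ~~ gap h' la' -> ~~ gap (h + h') (la + la').
Proof.
rewrite /gap mulnDl; case: h => [|h]; first by case: la.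
case: h' => [|h'] le le'; last lia.
by case: la' le' => // _; rewrite mul0n !addn0.
Qed.

(** Greedy choice of the digit. The extreme digits 0 and N are always allowed, as 2 <= r <= N; a
    neighbour N - 1 or 1 is taken when the extreme digit would leave a gap. *)
Lemma gap_digit h la : la <= h.+1 * N -> ~~ gap h.+1 la ->
  exists e, [/\ e <= N, e != n - r, e <= la, la - e <= h * N & ~~ gap h (la - e)].
Proof.
move=> le gp.
have c_bnd : 0 < n - r <= N - 1 by lia.
have [c1|cN1] := eqVneq (n - r) 1.
  have [laN|laN] := leqP la N.
    exists la; rewrite subnn; move: le gp; rewrite /gap mulSn; split; lia.
  (* Removing N would leave the gap 1; removing N - 1 leaves 2. *)
  have [e|e] := eqVneq la N.+1.
    exists (N - 1); move: le gp; rewrite /gap mulSn.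
    by case: h => [|h]; rewrite ?mulSn; split; lia.
  by exists N; move: le gp; rewrite /gap mulSn; split; lia.
have [laN|laN] := leqP N la.
  have [e|e] := eqVneq la (N + (n - r)).
    (* The digit N would leave c = [n - r]. If c = N - 1, then [la] is 2 N - 1, which is not a gap
       only if at least two digits remain, and c is then harmless; otherwise N - 1 is allowed and
       leaves c + 1. *)
    have [cN|cN] := eqVneq (n - r) (N - 1).
      exists N; move: le gp; rewrite /gap mulSn; split; lia.
    exists (N - 1); move: le gp; rewrite /gap mulSn.
    by case: h => [|h]; rewrite ?mulSn; split; lia.
  exists N; move: le gp; rewrite /gap mulSn; split; lia.
case: h le gp => [|h] le gp.
  exists la; move: le gp; rewrite /gap mulSn subnn; split; lia.
(* The digit 0 would leave c; the digit 1 differs from c here. *)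
have [e|e] := eqVneq la (n - r).
  exists 1; move: le gp; rewrite /gap !mulSn; split; lia.
exists 0; move: le gp; rewrite /gap !mulSn; split; lia.
Qed.

Lemma Psemi0 : Psemi m1 d n r 0%MM.
Proof. by exists (fun=> 0); rewrite big1 // => i _; rewrite mulm0n. Qed.

Lemma PsemiD s t : Psemi m1 d n r s -> Psemi m1 d n r t ->
  Psemi m1 d n r (s + t)%MM.
Proof.
move=> [k ->] [l ->]; exists (fun i => k i + l i).
rewrite -big_split /=; apply: eq_bigr => i _.
by apply/mnmP => x; rewrite !(mnmDE, mulmnE) mulnDr.
Qed.

Lemma Psemi_agen i : 0 < i < n.+2 -> i != r -> Psemi m1 d n r (a i).
Proof.
move=> ib ir; exists (fun j => j == i :> nat).
rewrite big_mkcond (bigD1_seq i) ?mem_index_iota ?iota_uniq //= ir eqxx mulm1n.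
rewrite big1 ?addm0 // => j /negPf ->; rewrite mulm0n; exact: if_same.
Qed.

(** Forward, the points on the right contain the generators and are closed under addition by
    [gap_add]; backward, [gap_digit] peels off one generator at a time. *)
Lemma Psemi_gap s : Psemi m1 d n r s <->
  exists h la j, [/\ rep s la h j, la <= h * N & ~~ gap h la].
Proof.
split.
  pose Q t := exists h la j, [/\ rep t la h j, la <= h * N & ~~ gap h la].
  have Q0 : Q 0%MM.
    by exists 0, 0, 0; split=> //; [exact: rep0 | rewrite /gap; lia].
  have QD t t' : Q t -> Q t' -> Q (t + t')%MM.
    move=> [h [la [j [tr le gp]]]] [h' [la' [j' [tr' le' gp']]]].
    exists (h + h'), (la + la'), (j + j'); split; first exact: rep_add.
      by rewrite mulnDl leq_add.
    exact: gap_add.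
  case=> k ->; rewrite big_seq_cond; apply: (big_ind Q) => // i /andP[].
  rewrite mem_index_iota => ib ir.
  elim: (k i) => [|l IHl]; first by rewrite mulm0n.
  rewrite mulmS; apply: QD IHl; have [ile|nlt] := leqP i n.
    exists 1, (n - i), 0; split; [apply: rep_agen; lia | lia | rewrite /gap; lia].
  have -> : i = n.+1 by lia.
  by exists 0, 0, 1; split=> //; [exact: rep_agenS | rewrite /gap; lia].
move=> [h]; elim: h s => [|h IHh] s [la [j [sr le gp]]].
  have la0 : la = 0 by lia. subst la.
  have -> : s = (a n.+1 *+ j)%MM.
    by apply: rep_inj sr _; have := rep_mul j rep_agenS; rewrite !mul0n mul1n.
  elim: j {sr} => [|j IHj]; first by rewrite mulm0n; apply: Psemi0.
  by rewrite mulmS; apply: PsemiD IHj; apply: Psemi_agen; lia.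
have [e [eN ec ela le' gp']] := gap_digit le gp.
have [t tr] := rep_ex j le'.
have -> : s = (t + a (n - e))%MM.
  apply: rep_inj sr _.
  have := rep_add tr (@rep_agen (n - e) _); rewrite subKn; last by lia.
  by rewrite subnK // addn1 addn0; apply; lia.
apply: PsemiD; first by apply: IHh; exists (la - e), j.
by apply: Psemi_agen; lia.
Qed.

(* The point (H M - la d, la d + J M) lies in P_r; the witness u says that it is
   obtained from la + u M, H + u d and J - u d. *)
Definition good (la H J : nat) : Prop :=
  exists u, [/\ u * d <= J, la + u * m1 <= H * N &
                ~~ gap (H + u * d) (la + u * M)].

Lemma Psemi_good s : Psemi m1 d n r s <->
  exists la H J, [/\ la < M, rep s la H J & good la H J].
Proof.
rewrite Psemi_gap; split=> [[h [la [j [sr le gp]]]]|].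
  rewrite (divn_eq la M) addnC in sr le gp.
  set u := la %/ M in sr le gp; set la0 := la %% M in sr le gp.
  (* Because u d N <= u M <= la <= h N, moving u d units from H to J leaves H nonnegative. *)
  have uh : u * d <= h.
    rewrite -(@leq_pmul2r N) ?(leq_trans _ le) ?mseqE; nia.
  rewrite -(subnK uh) in sr le gp; move/rep_shift: sr => sr.
  exists la0, (h - u * d), (j + u * d); split=> //.
    by rewrite ltn_mod mseq_gt0.
  by exists u; rewrite leq_addl; split=> //; move: le; rewrite mseqE; nia.
move=> [la [H [J [laM sr [u [uJ le gp]]]]]].
exists (H + u * d), (la + u * M), (J - u * d); split=> //.
  by apply/rep_shift; rewrite subnK.
by rewrite mseqE; nia.
Qed.

(** In a class outside [L] the witness u = 0 always works, so the only constraint is la <= H N and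
    the class is the free module on [s_ la]. Only the classes in [L] need generators of their
    own. *)
Lemma Psemi_generated (L : seq nat) (E : seq N2) :
    {in L, forall la, la < M} ->
    (forall la H, la < M -> la \notin L -> la <= H * N -> ~~ gap H la) ->
    (forall s, (exists2 g, g \in E & exists m, s = (mdeg m + g)%MM) <->
      exists la H J, [/\ la \in L, rep s la H J & good la H J]) ->
  forall s, Psemi m1 d n r s <->
    exists2 g, g \in sdegs_except m1 d n L ++ E & exists m, s = (mdeg m + g)%MM.
Proof.
move=> LM regular exceptional s; rewrite Psemi_good; split.
  move=> [la [H [J [laM sr laHJ]]]]; have [laL|laL] := boolP (la \in L).
    have /exceptional[g gE gs] : exists la H J,
        [/\ la \in L, rep s la H J & good la H J] by exists la, H, J.
    by exists g => //; rewrite mem_cat gE orbT.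
  exists (s_ la).
    by rewrite mem_cat map_f // mem_filter laL mem_iota.
  apply/(rep_above _ (rep_sdeg la)); exists H, J; split=> //.
  by rewrite ceil_div_le; case: laHJ => u []; lia.
move=> [g]; rewrite mem_cat => /orP[/mapP[la]|gE gs].
  rewrite mem_filter mem_iota => /andP[laL /= laM] -> /(rep_above _ (rep_sdeg la)).
  move=> [H [J [+ _ sr]]]; rewrite ceil_div_le => le.
  exists la, H, J; split=> //; exists 0; rewrite !mul0n !addn0; split=> //.
  exact: regular.
have /exceptional[la [H [J [laL sr laHJ]]]] :
  exists2 g, g \in E & exists m, s = (mdeg m + g)%MM by exists g.
by exists la, H, J; split=> //; exact: LM.
Qed.

Lemma free_resolution (K : fieldType) L f H0 J0 :
    uniq L -> {in L, forall la, la < M} ->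
    (forall la H, la < M -> la \notin L -> la <= H * N -> ~~ gap H la) ->
    {in L, forall la, rep (f la) la (H0 la) (J0 la)} ->
    {in L, forall la H J, good la H J <-> H0 la <= H /\ J0 la <= J} ->
  noether_resolution K (a n) (a n.+1) (Psemi m1 d n r)
    [:: sdegs_except m1 d n L ++ map f L].
Proof.
move=> uL LM regular fr exceptional.
apply: (@one_step_resolution K _ _ residue _ _ mdeg_inj residue_mdegD).
  by apply: uniq_residues => // la /fr; exists (H0 la), (J0 la).
apply: Psemi_generated => // s; split=> [[_ /mapP[la laL ->]]|[la [H [J [laL sr]]]]].
  case/(rep_above _ (fr _ laL)) => H [J [leH leJ sr]].
  by exists la, H, J; split=> //; apply/exceptional.
case/exceptional=> // leH leJ; exists (f la); first exact: map_f.
by apply/(rep_above _ (fr _ laL)); exists H, J.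
Qed.

(** The condition on H and J describes the ideal (x, y^d) translated by [g la]. *)
Lemma pair_resolution (K : fieldType) L g H0 :
    uniq L -> {in L, forall la, la < M} ->
    (forall la H, la < M -> la \notin L -> la <= H * N -> ~~ gap H la) ->
    {in L, forall la, rep (g la) la (H0 la) 0} ->
    {in L, forall la H J,
      good la H J <-> H0 la <= H /\ (H0 la < H \/ d <= J)} ->
  noether_resolution K (a n) (a n.+1) (Psemi m1 d n r)
    [:: sdegs_except m1 d n L ++ [seq (g la + a n)%MM | la <- L]
          ++ [seq (g la + a n.+1 *+ d)%MM | la <- L];
        [seq (g la + a n + a n.+1 *+ d)%MM | la <- L]].
Proof.
move=> uL LM regular gr exceptional.
have g1r la : la \in L -> rep (g la + a n)%MM la (H0 la + 1) 0.
  by move=> /gr/rep_add/(_ rep_an); rewrite !addn0.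
have g2r la : la \in L -> rep (g la + a n.+1 *+ d)%MM la (H0 la) d.
  by move=> /gr/rep_add/(_ (rep_mul d rep_agenS)); rewrite !mul0n mul1n !addn0.
have := @two_step_resolution K _ _ (sdegs_except m1 d n L) (map g L) d residue
  (Psemi m1 d n r) mdeg_inj residue_mdegD.
rewrite /gens /syzs -!map_comp; apply=> //.
  by apply: uniq_residues => // la /gr; exists (H0 la), 0.
apply: Psemi_generated => // s; split=> [[x]|[la [H [J [laL sr]]]]].
  rewrite mem_cat => /orP[] /mapP[la laL ->].
    case/(rep_above _ (g1r _ laL)) => H [J [leH leJ sr]].
    by exists la, H, J; split=> //; apply/exceptional => //; lia.
  case/(rep_above _ (g2r _ laL)) => H [J [leH leJ sr]].
  by exists la, H, J; split=> //; apply/exceptional => //; lia.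
case/exceptional=> // leH [ltH|leJ].
  exists (g la + a n)%MM.
    by rewrite mem_cat; apply/orP; left; apply/mapP; exists la.
  by apply/(rep_above _ (g1r _ laL)); exists H, J; rewrite addn1.
exists (g la + a n.+1 *+ d)%MM.
  by rewrite mem_cat; apply/orP; right; apply/mapP; exists la.
by apply/(rep_above _ (g2r _ laL)); exists H, J.
Qed.

(** * The monomial ideal of each exceptional class *)

Lemma regular_Lambda1 la H : r = 2 ->
  la < M -> la \notin Lambda1 m1 d n -> ~~ gap H la.
Proof.
move=> r2 laM laL; rewrite /gap r2; apply/negP => gp; case/negP: laL.
apply/mem_Lambda1; split=> //; exists H; case: H gp => [|[|H]]; lia.
Qed.

(** At H = mu the witness u = 0 meets a gap, and u >= 1 fails since la + m1 > mu N for m1 >= 2. *)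
Lemma good_Lambda1 la H J : r = 2 -> 1 < m1 -> la \in Lambda1 m1 d n ->
  good la H J <-> ceil_div la N + 1 <= H /\ 0 <= J.
Proof.
move=> r2 m1_gt1 /mem_Lambda1[laM [mu mu0 laE]]; rewrite (ceil_div_Lambda1 laE).
split=> [[[|u] [_ le gp]]|[leH _]].
- move: le gp; rewrite !mul0n !addn0 /gap r2 laE.
  by have [lt|//|<-] := ltngtP mu H; nia.
- by split=> //; nia.
- exists 0; rewrite !mul0n !addn0 /gap; split=> //; nia.
Qed.

Lemma good_Lambda1_m1 la H J : r = 2 -> m1 = 1 -> la \in Lambda1 m1 d n ->
  good la H J <-> ceil_div la N <= H /\ (ceil_div la N < H \/ d <= J).
Proof.
move=> r2 m1E /mem_Lambda1[laM [mu mu0 laE]]; rewrite (ceil_div_Lambda1 laE).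
split=> [[[|u] [uJ le gp]]|[leH]].
- move: le gp; rewrite !mul0n !addn0 /gap r2 laE.
  by have [lt|//|<-] := ltngtP mu H; nia.
- by split; [nia | right; nia].
have [ltH _|ge [|dJ]] := ltnP mu H; last 2 first; first by lia.
(* At H = mu, la + m1 = mu N still fits when m1 = 1, so one shift by M avoids the gap at the price
   of d units of J. *)
- exists 1; rewrite !mul1n /gap mseqE; split=> //; nia.
- exists 0; rewrite !mul0n !addn0 /gap; split=> //; nia.
Qed.

(** For r > 2 the digit c is below N - 1, and the two clauses of [gap] that remain both force la =
    c. *)
Lemma regular_middle la H : 2 < r -> la \notin [:: n - r] -> la <= H * N -> ~~ gap H la.
Proof.
rewrite /gap inE; lia.
Qed.

(** The inequality r <= m1 says (n - r) + m1 > N, so no shift by M is possible at H = 1, where u = 0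
    meets a gap. *)
Lemma good_middle_free H J : 3 <= r <= n - 2 -> r <= m1 ->
  good (n - r) H J <-> 2 <= H /\ 0 <= J.
Proof.
move=> rb rm; split=> [[[|u] [_ le gp]]|[leH _]].
- by split=> //; move: gp; rewrite /gap; case: H le => [|[|H]]; lia.
- by split=> //; nia.
- exists 0; rewrite !mul0n !addn0 /gap; split=> //; nia.
Qed.

(** Now (n - r) + m1 <= N, so at H = 1 the shift u = 1 becomes available once d <= J. *)
Lemma good_middle_pair H J : 3 <= r <= n - 2 -> m1 < r ->
  good (n - r) H J <-> 1 <= H /\ (1 < H \/ d <= J).
Proof.
move=> rb rm; split=> [[[|u] [uJ le gp]]|[H1]].
- by move: gp; rewrite /gap; case: H le => [|[|H]]; lia.
- by split; [nia | right; nia].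
have [ltH _|ge [|dJ]] := ltnP 1 H; last 2 first; first by lia.
- exists 1; rewrite !mul1n /gap mseqE; split=> //; nia.
- exists 0; rewrite !mul0n !addn0 /gap; split=> //; nia.
Qed.

(** For c = 1, [la] = 1 is a gap for every H, so some shift is unavoidable; u = 1 is the
    cheapest. *)
Lemma good_last H J : r = n - 1 -> good 1 H J <-> m1 < H * N /\ d <= J.
Proof.
move=> rE; split=> [[[|u] [uJ le gp]]|[leH leJ]].
- by move: gp; rewrite /gap; lia.
- by split; nia.
- exists 1; rewrite !mul1n /gap mseqE; split=> //; nia.
Qed.

(** * Assembling the six resolutions *)

Variable K : fieldType.
Local Notation resolution :=
  (noether_resolution K (a n) (a n.+1) (Psemi m1 d n r)).
Local Notation L1 := (Lambda1 m1 d n).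
Local Notation Sx := (sdegs_except m1 d n).

Lemma middle_lt : {in [:: n - r], forall la, la < M}.
Proof. by move=> la; rewrite inE mseqE => /eqP ->; nia. Qed.

Lemma resolution_r2 : r = 2 -> 1 < m1 ->
  resolution [:: Sx L1 ++ [seq (s_ la + a n)%MM | la <- L1]].
Proof.
move=> r2 m1_gt1.
apply: (@free_resolution _ _ _ (fun la => ceil_div la N + 1) (fun=> 0)).
- exact: uniq_Lambda1.
- exact: Lambda1_lt.
- by move=> la H laM laL _; apply: regular_Lambda1.
- by move=> la _; have := rep_add (rep_sdeg la) rep_an; rewrite !addn0.
- by move=> la laL H J; apply: good_Lambda1.
Qed.

Lemma resolution_middle_free : 3 <= r <= n - 2 -> r <= m1 ->
  resolution [:: Sx [:: n - r] ++ [:: (a r + a n)%MM]].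
Proof.
move=> rb rm.
apply: (@free_resolution _ [:: n - r] (fun=> (a r + a n)%MM) (fun=> 2) (fun=> 0)).
- by [].
- exact: middle_lt.
- by move=> la H _ laL le; apply: regular_middle => //; lia.
- move=> la; rewrite inE => /eqP ->.
  by have := rep_add (@rep_agen r _) rep_an; rewrite !addn0; apply; lia.
- by move=> la; rewrite inE => /eqP -> H J; apply: good_middle_free.
Qed.

(** The parameter [k] covers both r = n - 1 cases: q + epsilon when n - 1 <= m1, and 0 when m1 < n -
    1. *)
Lemma resolution_last (k : nat) : r = n - 1 ->
    (forall H, (m1 < H * N) = (k < H)) ->
  resolution [:: Sx [:: 1] ++ [:: (a N + a n *+ k + a n.+1 *+ d)%MM]].
Proof.
move=> rE kE; have nr1 : n - r = 1 by lia.
apply: (@free_resolution _ [:: 1] (fun=> (a N + a n *+ k + a n.+1 *+ d)%MM)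
  (* The extra unit in H comes from a_(n-1) itself, which counts as one digit. *)
  (fun=> k.+1) (fun=> d)).
- by [].
- by move: middle_lt; rewrite nr1.
- by move=> la H _ laL le; apply: regular_middle; rewrite ?nr1 //; lia.
- move=> la; rewrite inE => /eqP ->.
  have := rep_add (rep_add (@rep_agen N _) (rep_mul k rep_an)) (rep_mul d rep_agenS).
  have -> : n - N = 1 by lia.
  by rewrite !(mul0n, mul1n, addn0, add0n); apply; lia.
- by move=> la; rewrite inE => /eqP -> H J; rewrite -kE; apply: good_last.
Qed.

Lemma resolution_r2_m1 : r = 2 -> m1 = 1 ->
  resolution [:: Sx L1 ++ [seq (s_ la + a n)%MM | la <- L1]
                  ++ [seq (s_ la + a n.+1 *+ d)%MM | la <- L1];
                 [seq (s_ la + a n + a n.+1 *+ d)%MM | la <- L1]].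
Proof.
move=> r2 m1_1; apply: (@pair_resolution _ _ _ (fun la => ceil_div la N)).
- exact: uniq_Lambda1.
- exact: Lambda1_lt.
- by move=> la H laM laL _; apply: regular_Lambda1.
- by move=> la _; apply: rep_sdeg.
- by move=> la laL H J; apply: good_Lambda1_m1.
Qed.

Lemma resolution_middle_pair : 3 <= r <= n - 2 -> m1 < r ->
  resolution [:: Sx [:: n - r] ++ [:: (a r + a n)%MM; (a r + a n.+1 *+ d)%MM];
                 [:: (a r + a n + a n.+1 *+ d)%MM]].
Proof.
move=> rb rm; apply: (@pair_resolution _ [:: n - r] (fun=> a r) (fun=> 1)).
- by [].
- exact: middle_lt.
- by move=> la H _ laL le; apply: regular_middle => //; lia.
- by move=> la; rewrite inE => /eqP ->; apply: rep_agen; lia.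
- by move=> la; rewrite inE => /eqP -> H J; apply: good_middle_pair.
Qed.

End ArithmeticSemigroup.

Theorem theorem7 (K : fieldType) (n m1 d r : nat)
    (K_inf : infinite_type K) (n_ge4 : 4 <= n) (m1_gt0 : 0 < m1)
    (d_gt0 : 0 < d) (m1d : coprime m1 d) (r_bnd : 2 <= r <= n - 1) :
  let a := agen m1 d n in
  let s := sdeg m1 d n in
  let q := qpar m1 n in
  let e := epar m1 n in
  let L1 := Lambda1 m1 d n in
  let L2 := Lambda2 d n in
  let Sx := sdegs_except m1 d n in
  let resolution := noether_resolution K (a n) (a n.+1) (Psemi m1 d n r) in
  (r = 2 -> 2 <= m1 ->
     resolution [:: Sx L1 ++ [seq (s la + a n)%MM | la <- L1]]) /\
  (3 <= r <= n - 2 -> r <= m1 ->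
     resolution [:: Sx [:: n - r] ++ [:: (a r + a n)%MM]]) /\
  (r = n - 1 -> n - 1 <= m1 ->
     resolution
       [:: Sx [:: 1] ++ [:: (a (n - 1)%N + a n *+ (q + e)%N + a n.+1 *+ d)%MM]]) /\
  (r = 2 -> m1 = 1 ->
     resolution
       [:: Sx L2 ++ [seq (s la + a n)%MM | la <- L2]
             ++ [seq (s la + a n.+1 *+ d)%MM | la <- L2];
           [seq (s la + a n + a n.+1 *+ d)%MM | la <- L2]]) /\
  (3 <= r <= n - 2 -> m1 < r ->
     resolution
       [:: Sx [:: n - r] ++ [:: (a r + a n)%MM; (a r + a n.+1 *+ d)%MM];
           [:: (a r + a n + a n.+1 *+ d)%MM]]) /\
  (r = n - 1 -> m1 < n - 1 ->
     resolution [:: Sx [:: 1] ++ [:: (a (n - 1)%N + a n.+1 *+ d)%MM]]).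
Proof.
move=> a s q e L1 L2 Sx resolution.
refine (conj _ (conj _ (conj _ (conj _ (conj _ _))))).
- exact: resolution_r2.
- exact: resolution_middle_free.
- by move=> rE _; apply: resolution_last => // H; apply: mul_gt_m1.
- by move=> r2 m1_1; rewrite /L2 (@Lambda2E n m1 d) //; apply: resolution_r2_m1.
- exact: resolution_middle_pair.
- move=> rE m1N; have := resolution_last n_ge4 m1_gt0 m1d d_gt0 r_bnd K (k := 0) rE.
  by rewrite mulm0n addm0; apply=> -[|H] //; rewrite mulSn ltn_addr.
Qed.
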